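(* Let $A$ be a fixed integer $2\times 2$ loss matrix with $\Delta_1>0$, $\Delta_2<0$, $\delta_1>0$, $\delta_2<0$ and $|\Delta_1|<|\Delta_2|$, and let $y_1^\ast,\dots,y_T^\ast$ be the optimal play of player Y against the Hedge algorithm in the game $A$ repeated $T$ times. Then for all sufficiently large $T$ there exists a time $t^d=t^d(T)\le T$, with $T-t^d=o(T)$ as $T\to\infty$, such that $y_1^\ast,\dots,y_{t^d}^\ast$ is periodic. Moreover, its least positive period is $$T^\ast=\frac{m(|\Delta_1|,|\Delta_2|)}{|\Delta_2|}+\frac{m(|\Delta_1|,|\Delta_2|)}{|\Delta_1|},$$ where $m(|\Delta_1|,|\Delta_2|)$ is the least common multiple of $|\Delta_1|$ and $|\Delta_2|$.
   Context: Game. $A=\begin{pmatrix} a_{11} & a_{12} \\ a_{21} & a_{22} \end{pmatrix}$ has integer entries; $a_{ij}$ is the loss of player X (rows) and the payoff of player Y (columns $L,R$). Put $\delta_1=a_{11}-a_{12}$, $\delta_2=a_{21}-a_{22}$, $\Delta_1=a_{11}-a_{21}$, $\Delta_2=a_{12}-a_{22}$, $e_L=(1,0)^T$, $e_R=(0,1)^T$. Asymptotic statements are for fixed $A$ and $T\to\infty$. The learning rate $\eta=\eta_T>0$ satisfies $c/\sqrt T\le \eta_T\le C/\sqrt T$ for constants $0<c\le C$ independent of $T$ (e.g. $\eta=\sqrt{8\ln 2/T}$). Hedge. Given actions $y_1,y_2,\dots\in\{e_L,e_R\}$ of player Y, the state is $s_1=0$, $s_{t+1}=h(s_t,y_t):=s_t+(-\Delta_1,-\Delta_2)y_t$,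 and player X plays $x_t=\left(\frac{1}{e^{-\eta s_t}+1},\frac{e^{-\eta s_t}}{e^{-\eta s_t}+1}\right)$ at time $t$ (this is the Hedge algorithm $x_{i,t}\propto\exp(-\eta\sum_{\tau<t}(Ay_\tau)_i)$). The stage payoff of Y is $r(s_t,y_t)=x_t^TAy_t$, i.e. $r(s,y)=\left(\frac{1}{e^{-\eta s}+1},\frac{e^{-\eta s}}{e^{-\eta s}+1}\right)Ay$. Optimal play. Player Y maximizes the cumulative payoff $\sum_{t=1}^Tr(s_t,y_t)$. Let $f^\ast_{T+1}\equiv0$ and $f^\ast_t(s)=\max_{y\in\{e_L,e_R\}}\{r(s,y)+f^\ast_{t+1}(h(s,y))\}$ for $1\le t\le T$ (Bellman equation). The optimal action of state $s$ at time $t$ is the maximizing $y$, with ties resolved in favour of $e_L$. The optimal play $y_1^\ast,\dots,y_T^\ast$ and optimal states $s_1^\ast,\dots,s_{T+1}^\ast$ are obtained by starting at $s_1^\ast=0$ and taking the optimal action of $s_t^\ast$ at each time $t$. A finite sequence $a_1,\dots,a_n$ is periodic with period $p\ge1$ if $a_{t+p}=a_t$ whenever $1\le t$ and $t+p\le n$. *)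

(* Defs.v *)
From mathcomp Require Import all_boot all_order all_algebra.
From mathcomp Require Import all_classical all_reals all_analysis.
Import Order.TTheory GRing.Theory Num.Theory.
Import numFieldNormedType.Exports.

Set Implicit Arguments.
Unset Strict Implicit.
Unset Printing Implicit Defensive.

Local Open Scope ring_scope.

Section Game.
Variable A : 'M[int]_2.

Definition delta1 : int := A 0 0 - A 0 1.
Definition delta2 : int := A 1 0 - A 1 1.
Definition Delta1 : int := A 0 0 - A 1 0.
Definition Delta2 : int := A 0 1 - A 1 1.

Definition eL : 'cV[int]_2 := delta_mx 0 0.
Definition eR : 'cV[int]_2 := delta_mx 1 0.

(* The state is an integer, so the row vector (-Delta1, -Delta2) is kept over
   int; only the mixed strategy and the payoff live in R. *)
Definition next_state (s : int) (y : 'cV[int]_2) : int :=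
  s + ((\row_j (if j == 0 then - Delta1 else - Delta2)) *m y) 0 0.

(* The divisions are exact. *)
Definition lcm_period : nat :=
  (lcmn `|Delta1| `|Delta2| %/ `|Delta2|
   + lcmn `|Delta1| `|Delta2| %/ `|Delta1|)%N.

Section Play.
Variables (R : realType) (eta : R).

Definition hedge (s : int) : 'rV[R]_2 :=
  let w := expR (- eta * s%:~R) in
  \row_i (if i == 0 then 1 / (w + 1) else w / (w + 1)).

Definition payoff (s : int) (y : 'cV[int]_2) : R :=
  (hedge s *m map_mx intr A *m map_mx intr y) 0 0.

Definition bellman (f : int -> R) (s : int) : R :=
  Num.max (payoff s eL + f (next_state s eL))
          (payoff s eR + f (next_state s eR)).

Variable T : nat.

(* Backward recursion: stage t, for 1 <= t <= T + 1, is reached from the null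
   function of stage T + 1 by T + 1 - t Bellman steps; see optval_last and
   optval_rec. *)
Definition optval (t : nat) : int -> R := iter (T.+1 - t) bellman (fun=> 0).

Definition optact (t : nat) (s : int) : 'cV[int]_2 :=
  if payoff s eR + optval t.+1 (next_state s eR)
     <= payoff s eL + optval t.+1 (next_state s eL)
  then eL else eR.

(* Times start at 1, so optstate 1 = 0; see optstate_rec. *)
Definition optstate (t : nat) : int :=
  iteri t.-1 (fun i s => next_state s (optact i.+1 s)) 0.

Definition optplay (t : nat) : 'cV[int]_2 := optact t (optstate t).

Lemma optval_last s : optval T.+1 s = 0.
Proof. by rewrite /optval subnn. Qed.

Lemma optval_rec t s : (1 <= t <= T)%N ->
  optval t s = Num.max (payoff s eL + optval t.+1 (next_state s eL))
                       (payoff s eR + optval t.+1 (next_state s eR)).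
Proof. by case/andP=> _ tT; rewrite /optval subSS subSn. Qed.

Lemma optstate1 : optstate 1 = 0.
Proof. by []. Qed.

Lemma optstate_rec t : (1 <= t)%N ->
  optstate t.+1 = next_state (optstate t) (optplay t).
Proof. by case: t. Qed.

End Play.
End Game.

(* Periodicity of the finite sequence a 1, ..., a n. *)
Definition periodic (X : Type) (a : nat -> X) (n p : nat) : Prop :=
  (1 <= p)%N /\ forall t, (1 <= t)%N -> (t + p <= n)%N -> a (t + p)%N = a t.

Definition least_period (X : Type) (a : nat -> X) (n p : nat) : Prop :=
  periodic a n p /\ forall q, periodic a n q -> (p <= q)%N.

(* Main.v *)
Require Import Defs.
From mathcomp Require Import all_boot all_order all_algebra.
From mathcomp Require Import all_classical all_reals all_analysis.
From mathcomp Require Import ring lra zify.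
Import Order.TTheory GRing.Theory Num.Theory.
Import numFieldNormedType.Exports.
Local Open Scope classical_set_scope.
Local Open Scope ring_scope.

(** L moves the state by -a and R by +b, with a = |Delta1| and b = |Delta2|.
    Playing LR or RL from s leads to the same state, and the difference of the
    two payoffs, [swap_gain s], depends on s only and changes sign once, from
    negative to nonnegative.  By this exchange argument optimal play follows
    the rule "L iff swap_gain s >= 0" up to a first deviation, after which it
    repeats one action until time T.  The rule keeps the orbit of 0 in a window
    of length a + b; since both moves agree modulo a + b, the orbit is a
    rotation of Z/(a + b), whence the period.  Repeating one action pays
    strictly less than the value of the game per stage, up to a total excess
    O(1/eta), while player Y can secure the value at every stage; so the
    deviation occurs only O(sqrt T) stages before the end. *)

(** With [f 0 = 0], strict concavity makes the chord slope [f k / k] strictly decreasing; [slopeS]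
    is the one-step case, denominators cleared. *)
Lemma concave_seq_slope (R : realFieldType) (f : nat -> R) (m n : nat) :
  f 0%N = 0 -> (forall k, f k + f k.+2 < 2 * f k.+1) -> (0 < m < n)%N ->
  m%:R * f n < n%:R * f m.
Proof.
move=> f0 fconc /andP[m0 mn].
have slopeS k : k.+1%:R * f k.+2 < k.+2%:R * f k.+1.
  elim: k => [|k IH]; first by have := fconc 0%N; rewrite f0; lra.
  have Hk := fconc k.+1; have k0 : (0 : R) < k.+2%:R by rewrite ltr0n.
  have := ltr_pM2l k0 (f k.+1 + f k.+3) (2 * f k.+2); rewrite Hk => Hm.
  rewrite -[k.+3]addn1 natrD -{2}[k.+2]addn1 natrD in IH Hm *.
  nra.
rewrite -(subnKC mn); elim: (n - m.+1)%N => [|k IH].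
  by rewrite addn0; case: m m0 {mn} => // m _; exact: slopeS.
rewrite addnS addSn in IH *; set p := (m + k)%N in IH *.
have p0 : (0 : R) < p.+1%:R by rewrite ltr0n.
have m0' : (0 : R) < m%:R by rewrite ltr0n.
rewrite -(ltr_pM2l p0) mulrCA (lt_trans (y := m%:R * (p.+2%:R * f p.+1))) //.
  by rewrite ltr_pM2l.
by rewrite !(mulrCA _ p.+2%:R) ltr_pM2l ?ltr0n.
Qed.

(** * Tail bounds, symmetry and concavity of the logistic function *)

Section Logistic.
Variables (R : realType) (eta : R).
Hypothesis eta_gt0 : 0 < eta.

Definition logistic (s : int) : R := 1 / (expR (- eta * s%:~R) + 1).

Lemma logistic_le_expR s : logistic s <= expR (eta * s%:~R).
Proof.
rewrite /logistic mulNr expRN; set u := expR _.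
have u0 : 0 < u by exact: expR_gt0.
have -> : 1 / (u^-1 + 1) = u / (1 + u) by field; apply/andP; split; lra.
by rewrite ler_pdivrMr; nra.
Qed.

Lemma logistic_ge_expR s : 1 - expR (- eta * s%:~R) <= logistic s.
Proof.
rewrite /logistic; set w := expR _; have w0 : 0 < w by exact: expR_gt0.
by rewrite ler_pdivlMr; nra.
Qed.

Lemma logisticN s : logistic (- s) = 1 - logistic s.
Proof.
rewrite /logistic mulrNz mulrN mulNr opprK expRN; set u := expR _.
have u0 : 0 < u by exact: expR_gt0.
by field; apply/andP; split; lra.
Qed.

Lemma logistic0 : logistic 0 = 1 / 2.
Proof. by rewrite /logistic mulr0 expR0. Qed.

Lemma logistic_concave (k : nat) :
  logistic k + logistic k.+2 < 2 * logistic k.+1.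
Proof.
have E (j : nat) : logistic j = 1 - 1 / (expR eta ^+ j + 1).
  rewrite -expRM_natl /logistic mulNr expRN (mulrC eta) -[_%:~R]/(j%:R).
  set u := expR _.
  have u0 : 0 < u by exact: expR_gt0.
  by field; apply/andP; split; lra.
rewrite !E !exprS; set x := expR eta; set u := x ^+ k.
have x1 : 1 < x by rewrite /x expR_gt1.
have u1 : 1 <= u by rewrite /u exprn_ege1 // ltW.
have ux : 1 < x * u by nra.
have uxx : 1 < x * (x * u) by nra.
rewrite -subr_gt0.
(* The factor [x * u - 1] carries the sign; it is positive because [k.+1] lies to the right of 0. *)
have -> : 2 * (1 - 1 / (x * u + 1)) -
    (1 - 1 / (u + 1) + (1 - 1 / (x * (x * u) + 1))) =
    u * (x - 1) ^+ 2 * (x * u - 1) /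
      ((x * u + 1) * (u + 1) * (x * (x * u) + 1)).
  by field; apply/and3P; split; lra.
apply: divr_gt0; last by rewrite !mulr_gt0 //; lra.
rewrite mulr_gt0 ?mulr_gt0 ?exprn_gt0 //; lra.
Qed.

End Logistic.

(** * The swap gain and its sign *)

Section Threshold.
Variables (R : realType) (eta : R) (a b : nat).
Hypotheses (eta_gt0 : 0 < eta) (a_gt0 : (0 < a)%N) (b_gt0 : (0 < b)%N).

Local Notation lg := (logistic R eta).

(* Payoff of L then R minus payoff of R then L, both played from state s. *)
Definition swap_gain (s : int) : R :=
  (a + b)%:R * lg s - b%:R * lg (s - a%:Z) - a%:R * lg (s + b%:Z).

(* Up to a positive factor, swap_gain s is affine in exp (- eta s), with a
   nonnegative constant term. *)
Lemma swap_gain_mono s s' : s <= s' -> 0 <= swap_gain s -> 0 <= swap_gain s'.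
Proof.
pose x := expR (eta * a%:R); pose y := expR (eta * b%:R).
have x0 : 0 < x by exact: expR_gt0.
have y0 : 0 < y by exact: expR_gt0.
have a0 : (0 : R) < a%:R by rewrite ltr0n.
have b0 : (0 : R) < b%:R by rewrite ltr0n.
pose al := a%:R + b%:R * (x * y) - (a + b)%:R * y.
pose be := (a + b)%:R * x - b%:R - a%:R * (x * y).
have al0 : 0 <= al.
  have -> : al = y * (a%:R * expR (- (eta * b%:R)) + b%:R * x - (a + b)%:R).
    by rewrite expRN -/y /al; field; lra.
  apply: mulr_ge0; [exact: ltW|rewrite natrD].
  (* Tangent bounds for exp, weighted by [a] and [b]: the terms linear in [eta] cancel and [a + b]
     remains. *)
  have := expR_ge1Dx (- (eta * b%:R)); have := expR_ge1Dx (eta * a%:R).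
  rewrite -/x => Hx Hy.
  have := ler_wpM2l (ltW a0) Hy; have := ler_wpM2l (ltW b0) Hx; lra.
have sign t : (0 <= swap_gain t) = (0 <= al + be * expR (- eta * t%:~R)).
  rewrite /swap_gain /logistic; set w := expR (- eta * t%:~R).
  have w0 : 0 < w by exact: expR_gt0.
  have -> : expR (- eta * (t - a%:Z)%:~R) = w * x.
    by rewrite intrB /w /x -expRD; congr expR; rewrite -[(a%:Z)%:~R]/(a%:R); ring.
  have -> : expR (- eta * (t + b%:Z)%:~R) = w / y.
    by rewrite intrD /w /y -expRN -expRD; congr expR; rewrite -[(b%:Z)%:~R]/(b%:R); ring.
  have wx0 : 0 < w * x by exact: mulr_gt0.
  have -> : (a + b)%:R * (1 / (w + 1)) - b%:R * (1 / (w * x + 1)) -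
      a%:R * (1 / (w / y + 1)) =
      w / ((w + 1) * (w * x + 1) * (w + y)) * (al + be * w).
    rewrite /al /be natrD; field; apply/and4P; split; lra.
  by rewrite pmulr_rge0 // divr_gt0 // !mulr_gt0 //; lra.
move=> ss'; rewrite !sign.
have : expR (- eta * s'%:~R) <= expR (- eta * s%:~R).
  by rewrite ler_expR !mulNr lerN2 ler_pM2l // ler_int.
have := expR_gt0 (- eta * s'%:~R); set w := expR _; set w' := expR _ => w0 ww'.
(* The exponential decreases as the state grows: this helps if [be < 0], and if [be >= 0] the
   expression is nonnegative anyway. *)
have [be0|be0] := leP 0 be; nra.
Qed.

(** At state [a] the other two arguments are 0 and [a + b], so the sign compares chord slopes of the
    centred logistic at [a] and [a + b]. *)
Lemma swap_gain_ge0 : 0 <= swap_gain a%:Z.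
Proof.
have := @concave_seq_slope R (fun k : nat => lg k - 1 / 2) a (a + b).
rewrite logistic0 subrr a_gt0 -{1}[a]addn0 ltn_add2l b_gt0.
have H (k : nat) : lg k - 1 / 2 + (lg k.+2 - 1 / 2) < 2 * (lg k.+1 - 1 / 2).
  by have := @logistic_concave R eta eta_gt0 k; lra.
move=> /(_ erefl H erefl).
rewrite /swap_gain subrr logistic0 -PoszD natrD; lra.
Qed.

(** Mirror image through [logisticN], with chords at [b] and [a + b]. *)
Lemma swap_gain_lt0 : swap_gain (- b%:Z) < 0.
Proof.
have := @concave_seq_slope R (fun k : nat => lg k - 1 / 2) b (a + b).
rewrite logistic0 subrr b_gt0 -{1}[b]add0n ltn_add2r a_gt0.
have H (k : nat) : lg k - 1 / 2 + (lg k.+2 - 1 / 2) < 2 * (lg k.+1 - 1 / 2).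
  by have := @logistic_concave R eta eta_gt0 k; lra.
move=> /(_ erefl H erefl).
rewrite /swap_gain addNr logistic0 -opprD -PoszD !logisticN addnC natrD; lra.
Qed.

(** * The threshold rule and the period of its orbit *)

Definition plays_left (s : int) : bool := 0 <= swap_gain s.

Definition threshold_step (s : int) : int :=
  if plays_left s then s - a%:Z else s + b%:Z.

Definition threshold_orbit (n : nat) : int := iter n threshold_step 0.

(** If theta is the least left state, this invariant says [theta - a <= s < theta + b], without
    naming theta. *)
Lemma threshold_orbit_window n :
  plays_left (threshold_orbit n + a%:Z) && ~~ plays_left (threshold_orbit n - b%:Z).
Proof.
elim: n => [|n /andP[IHa IHb]].
  by rewrite add0r sub0r /plays_left swap_gain_ge0 -ltNge swap_gain_lt0.
rewrite /threshold_orbit iterS -/(threshold_orbit n).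
set s := threshold_orbit n in IHa IHb *.
rewrite /threshold_step; case: ifPn => Hs.
  rewrite subrK Hs; apply: contra IHb; apply: swap_gain_mono; lia.
rewrite addrK Hs andbT; apply: swap_gain_mono IHa; lia.
Qed.

Lemma threshold_orbit_bound n : - (a + b)%:Z < threshold_orbit n < (a + b)%:Z.
Proof.
case/andP: (threshold_orbit_window n); set s := threshold_orbit n => Ha Hb.
apply/andP; split; rewrite ltNge; apply/negP => H.
  have /swap_gain_mono/(_ Ha) : s + a%:Z <= - b%:Z by lia.
  by rewrite leNgt swap_gain_lt0.
by move: Hb; rewrite /plays_left (swap_gain_mono a%:Z) ?swap_gain_ge0 //; lia.
Qed.

Lemma threshold_orbit_count n :
  exists l r : nat, (l + r = n)%N /\ threshold_orbit n = (b * r)%:Z - (a * l)%:Z.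
Proof.
elim: n => [|n [l [r [lr E]]]]; first by exists 0%N, 0%N; rewrite !muln0.
rewrite /threshold_orbit iterS -/(threshold_orbit n) {1}/threshold_step.
case: ifP => _; [exists l.+1, r|exists l, r.+1]; split; rewrite ?E; lia.
Qed.

Definition cycle_length : nat := (lcmn a b %/ b + lcmn a b %/ a)%N.

Lemma threshold_orbit_periodic n :
  threshold_orbit (n + cycle_length) = threshold_orbit n.
Proof.
have [l [r [lr E]]] := threshold_orbit_count n.
have [l' [r' [lr' E']]] := threshold_orbit_count (n + cycle_length).
case/andP: (threshold_orbit_window n) => Ha Hb.
case/andP: (threshold_orbit_window (n + cycle_length)) => Ha' Hb'.
have La : (lcmn a b %/ a * a = lcmn a b)%N by rewrite divnK ?dvdn_lcml.
have Lb : (lcmn a b %/ b * b = lcmn a b)%N by rewrite divnK ?dvdn_lcmr.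
rewrite /cycle_length in lr' E' Ha' Hb' *.
set qa := (lcmn a b %/ a)%N in La lr' E' Ha' Hb' *.
set qb := (lcmn a b %/ b)%N in Lb lr' E' Ha' Hb' *.
set s' := threshold_orbit _ in E' Ha' Hb' *; set s := threshold_orbit n in E Ha Hb *.
have [k Ek] : exists k : int, s' - s = (a + b)%:Z * k.
  (* Each state is [b (l + r) - (a + b) l], and the time shift adds [b (qb + qa) = (a + b) qa] to
     the first term. *)
  exists (qa%:Z - (l'%:Z - l%:Z)).
  have -> : s' = (b * (l + r + (qb + qa)))%:Z - ((a + b) * l')%:Z by rewrite E'; nia.
  have : (qb * b)%:Z = (qa * a)%:Z by rewrite La Lb.
  rewrite E !PoszM !PoszD !mulrDr !mulrDl; lia.
(* Two states of one window are less than [a + b] apart; both orders together force [k = 0]. *)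
have apart t t' : plays_left (t + a%:Z) -> ~~ plays_left (t' - b%:Z) ->
    t' - t < (a + b)%:Z.
  move=> Pt Pt'; rewrite ltNge; apply: contra Pt' => H.
  by apply: swap_gain_mono Pt; lia.
have ab0 : (0 : int) < (a + b)%:Z by lia.
have := apart _ _ Ha Hb'; rewrite Ek -[ltRHS]mulr1 ltr_pM2l // => k1.
have := apart _ _ Ha' Hb; rewrite -opprB Ek -mulrN -[ltRHS]mulr1 ltr_pM2l // => k1'.
have k0 : k = 0 by lia.
by move: Ek; rewrite k0 mulr0 => /eqP; rewrite subr_eq0 => /eqP.
Qed.

(** A return gives [b r = a l], a positive common multiple, so [r] and [l] are at least the two
    quotients of the lcm. *)
Lemma threshold_orbit_return n :
  (0 < n)%N -> threshold_orbit n = 0 -> (cycle_length <= n)%N.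
Proof.
move=> n0; have [l [r [lr ->]]] := threshold_orbit_count n => E.
have {}E : (b * r = a * l)%N by lia.
have l0 : (0 < l)%N by case: l E lr => [|//]; nia.
have r0 : (0 < r)%N by case: r E lr => [|//]; nia.
rewrite -lr addnC leq_add // leq_divLR ?dvdn_lcmr ?dvdn_lcml //.
  by apply: dvdn_leq; rewrite ?muln_gt0 ?r0 // dvdn_lcm mulnC {1}E !dvdn_mulr.
by apply: dvdn_leq; rewrite ?muln_gt0 ?l0 // dvdn_lcm mulnC -{2}E !dvdn_mulr.
Qed.

Lemma cycle_length_gt0 : (0 < cycle_length)%N.
Proof.
rewrite /cycle_length addn_gt0 divn_gt0 //; apply/orP; left.
by rewrite dvdn_leq ?dvdn_lcmr // lcmn_gt0 a_gt0.
Qed.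

End Threshold.

(** * Optimal play compared with the threshold rule *)

Section OptimalPlay.
Variables (R : realType) (A : 'M[int]_2) (eta : R) (T : nat).
Hypotheses (eta_gt0 : 0 < eta) (D1_gt0 : 0 < Delta1 A) (D2_lt0 : Delta2 A < 0).

Local Notation a := `|Delta1 A|%N.
Local Notation b := `|Delta2 A|%N.
Local Notation lg := (logistic R eta).
Local Notation left := (plays_left R eta a b).
Local Notation orbit := (threshold_orbit R eta a b).
Local Notation val n := (iter n (bellman A eta) (fun=> 0)).

Lemma absDelta1 : a%:Z = Delta1 A. Proof. by rewrite gtz0_abs. Qed.

Lemma absDelta2 : b%:Z = - Delta2 A. Proof. by rewrite ltz0_abs. Qed.

Lemma natrDelta1 : a%:R = (A 0 0)%:~R - (A 1 0)%:~R :> R.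
Proof. by rewrite -intrB -/(Delta1 A) -absDelta1. Qed.

Lemma natrDelta2 : b%:R = (A 1 1)%:~R - (A 0 1)%:~R :> R.
Proof. by rewrite -intrB -opprB -/(Delta2 A) -absDelta2. Qed.

Lemma absDelta1_gt0 : (0 < a)%N. Proof. by rewrite absz_gt0 gt_eqF. Qed.

Lemma absDelta2_gt0 : (0 < b)%N. Proof. by rewrite absz_gt0 lt_eqF. Qed.

Lemma next_state_eL s : next_state A s eL = s - a%:Z.
Proof.
by rewrite absDelta1 /next_state !mxE !big_ord_recl big_ord0 !mxE /= mulr1 mulr0 !addr0.
Qed.

Lemma next_state_eR s : next_state A s eR = s + b%:Z.
Proof.
by rewrite absDelta2 /next_state !mxE !big_ord_recl big_ord0 !mxE /= mulr1 mulr0 addr0 add0r.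
Qed.

Lemma hedge_second s :
  expR (- eta * s%:~R) / (expR (- eta * s%:~R) + 1) = 1 - lg s.
Proof.
rewrite /logistic; set w := expR _; have w0 : 0 < w by exact: expR_gt0.
by field; lra.
Qed.

Lemma payoff_eL s : payoff A eta s eL = (A 1 0)%:~R + a%:R * lg s.
Proof.
rewrite /payoff !mxE !big_ord_recl big_ord0 !mxE !big_ord_recl !big_ord0 !mxE /=.
rewrite hedge_second -/(lg s) natrDelta1.
have -> : lift ord0 ord0 = 1 :> 'I_2 by apply/val_inj.
have -> : ord0 = 0 :> 'I_2 by [].
ring.
Qed.

Lemma payoff_eR s : payoff A eta s eR = (A 1 1)%:~R - b%:R * lg s.
Proof.
rewrite /payoff !mxE !big_ord_recl big_ord0 !mxE !big_ord_recl !big_ord0 !mxE /=.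
rewrite hedge_second -/(lg s) natrDelta2.
have -> : lift ord0 ord0 = 1 :> 'I_2 by apply/val_inj.
have -> : ord0 = 0 :> 'I_2 by [].
ring.
Qed.

Lemma eL_neq_eR : (eL == eR) = false.
Proof. by apply/negP => /eqP/matrixP/(_ 0 0); rewrite !mxE. Qed.

Lemma optact_eR t s : optact A eta T t s = eR <->
  payoff A eta s eL + optval A eta T t.+1 (s - a%:Z) <
  payoff A eta s eR + optval A eta T t.+1 (s + b%:Z).
Proof.
rewrite /optact next_state_eL next_state_eR ltNge; case: leP => _; split=> //.
by move/eqP; rewrite eL_neq_eR.
Qed.

Lemma optact_eL t s : optact A eta T t s = eL <->
  payoff A eta s eR + optval A eta T t.+1 (s + b%:Z) <=
  payoff A eta s eL + optval A eta T t.+1 (s - a%:Z).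
Proof.
rewrite /optact next_state_eL next_state_eR; case: leP => _; split=> //.
by move/eqP; rewrite eq_sym eL_neq_eR.
Qed.

Lemma optact_cases t s : optact A eta T t s = eL \/ optact A eta T t s = eR.
Proof. by rewrite /optact; case: ifP; [left|right]. Qed.

Lemma optval_max t s : (1 <= t <= T)%N -> optval A eta T t s =
  Num.max (payoff A eta s eL + optval A eta T t.+1 (s - a%:Z))
          (payoff A eta s eR + optval A eta T t.+1 (s + b%:Z)).
Proof. by move=> tT; rewrite optval_rec // next_state_eL next_state_eR. Qed.

Lemma swap_gainE s : swap_gain R eta a b s =
  (payoff A eta s eL + payoff A eta (s - a%:Z) eR) -
  (payoff A eta s eR + payoff A eta (s + b%:Z) eL).
Proof. by rewrite /swap_gain natrD !payoff_eL !payoff_eR; ring. Qed.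

(* R then L could be swapped for L then R without loss, and ties go to L. *)
Lemma right_then_right t s : (t < T)%N -> left s ->
  optact A eta T t s = eR -> optact A eta T t.+1 (s + b%:Z) = eR.
Proof.
move=> tT; rewrite /plays_left swap_gainE => gain /optact_eR H.
case: (optact_cases t.+1 (s + b%:Z)) => // /optact_eL/max_idPl E.
move: H; rewrite !(@optval_max t.+1) // E.
have : payoff A eta (s - a%:Z) eR + optval A eta T t.+2 (s - a%:Z + b%:Z) <=
  Num.max (payoff A eta (s - a%:Z) eL + optval A eta T t.+2 (s - a%:Z - a%:Z))
    (payoff A eta (s - a%:Z) eR + optval A eta T t.+2 (s - a%:Z + b%:Z)).
  by rewrite le_max lexx orbT.
by rewrite [s - a%:Z + b%:Z]addrAC; set m := Num.max _ _ => *; exfalso; lra.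
Qed.

(** Mirror case: swapping L then R for R then L now gains strictly, which contradicts even a tie
    resolved towards L. *)
Lemma left_then_left t s : (t < T)%N -> ~~ left s ->
  optact A eta T t s = eL -> optact A eta T t.+1 (s - a%:Z) = eL.
Proof.
move=> tT; rewrite /plays_left -ltNge swap_gainE => gain /optact_eL H.
case: (optact_cases t.+1 (s - a%:Z)) => // /optact_eR/ltW/max_idPr E.
move: H; rewrite !(@optval_max t.+1) // E.
have : payoff A eta (s + b%:Z) eL + optval A eta T t.+2 (s + b%:Z - a%:Z) <=
  Num.max (payoff A eta (s + b%:Z) eL + optval A eta T t.+2 (s + b%:Z - a%:Z))
    (payoff A eta (s + b%:Z) eR + optval A eta T t.+2 (s + b%:Z + b%:Z)).
  by rewrite le_max lexx.
by rewrite [s - a%:Z + b%:Z]addrAC; set m := Num.max _ _ => *; exfalso; lra.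
Qed.

(* The left side is (a + b) n times the value of the game: whatever the mixed
   strategy of X, one of the two columns pays at least that value. *)
Lemma val_lower_bound n s :
  n%:R * (b%:R * (A 1 0)%:~R + a%:R * (A 1 1)%:~R) <= (a + b)%:R * val n s.
Proof.
have a0 : (0 : R) < a%:R by rewrite ltr0n absDelta1_gt0.
have b0 : (0 : R) < b%:R by rewrite ltr0n absDelta2_gt0.
elim: n s => [|n IH] s; first by rewrite mul0r mulr0.
rewrite iterS /bellman payoff_eL payoff_eR natrD -[n.+1]addn1 natrD in IH *.
set fL := val n _; set fR := val n _.
have HL : n%:R * _ <= _ * fL := IH _; have HR : n%:R * _ <= _ * fR := IH _.
set m := Num.max _ _.
have mL : (A 1 0)%:~R + a%:R * lg s + fL <= m by rewrite le_max lexx.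
have mR : (A 1 1)%:~R - b%:R * lg s + fR <= m by rewrite le_max lexx orbT.
have ab0 : 0 < a%:R + b%:R :> R by rewrite addr_gt0.
(* Weights [b] on L and [a] on R cancel the logistic terms. *)
have := ler_wpM2l (ltW b0) mL; have := ler_wpM2l (ltW a0) mR.
have := ler_wpM2l (ltW b0) HL; have := ler_wpM2l (ltW a0) HR.
move=> h1 h2 h3 h4.
have h5 := ler_wpM2l (ltW ab0) h3; have h6 := ler_wpM2l (ltW ab0) h4.
by rewrite -(ler_pM2l ab0); lra.
Qed.

(** Controls the total excess of a run: stage excesses shrinking by [exp (- eta m)] form a geometric
    series. *)
Lemma expR_decrement (m : nat) :
  m%:R <= (1 / eta + m%:R) * (1 - expR (- (eta * m%:R))).
Proof.
rewrite expRN; have := expR_ge1Dx (eta * m%:R); set y := expR _ => y1.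
have m0 : (0 : R) <= m%:R by exact: ler0n.
have em0 : 0 <= eta * m%:R by rewrite mulr_ge0 // ltW.
have y0 : 0 < y by lra.
rewrite -subr_ge0.
have -> : (1 / eta + m%:R) * (1 - y^-1) - m%:R =
  (y - (1 + eta * m%:R)) / (eta * y) by field; rewrite !gt_eqF.
by rewrite divr_ge0 ?subr_ge0 // mulr_ge0 // ltW.
Qed.

Lemma valS n s : val n.+1 s =
  Num.max (payoff A eta s eL + val n (s - a%:Z))
          (payoff A eta s eR + val n (s + b%:Z)).
Proof. by rewrite iterS {1}/bellman next_state_eL next_state_eR. Qed.

Lemma optval_next n : (n < T)%N -> optval A eta T (T.+1 - n.+1).+1 = val n.
Proof. by move=> nT; rewrite /optval !subSS subKn // ltnW. Qed.

(** [n] counts the stages left, so the time is [T.+1 - n]. By [right_then_right] R is repeated to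
    the end; each stage pays at most [A 0 1] plus [b exp (- eta s)], and [expR_decrement] sums these
    excesses. At [n = 0] no action is left, hence the guard. *)
Lemma val_right_run n s : (n <= T)%N -> left s ->
  ((0 < n)%N -> optact A eta T (T.+1 - n) s = eR) ->
  val n s <= n%:R * (A 0 1)%:~R + (1 / eta + b%:R) * expR (- eta * s%:~R).
Proof.
have K0 : 0 <= 1 / eta + b%:R by rewrite addr_ge0 ?ler0n // divr_ge0 // ltW.
elim: n s => [|n IH] s nT Ps act.
  by rewrite mul0r add0r mulr_ge0 ?expR_ge0.
have {}act := act isT.
have IHact : (0 < n)%N -> (T.+1 - n = (T.+1 - n.+1).+1)%N by lia.
rewrite valS (_ : Num.max _ _ = payoff A eta s eR + val n (s + b%:Z)); last first.
  apply/max_idPr/ltW; move/optact_eR: act.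
  by rewrite optval_next.
have {}IH : val n (s + b%:Z) <= n%:R * (A 0 1)%:~R +
    (1 / eta + b%:R) * expR (- eta * (s + b%:Z)%:~R).
  apply: IH; [exact: ltnW| |].
    by apply: swap_gain_mono Ps => //; rewrite ?absDelta1_gt0 ?absDelta2_gt0 //; lia.
  by move=> n0; rewrite IHact //; apply: right_then_right => //; lia.
have eE : expR (- eta * (s + b%:Z)%:~R) = expR (- eta * s%:~R) * expR (- (eta * b%:R)).
  by rewrite -expRD intrD; congr expR; rewrite -[(b%:Z)%:~R]/(b%:R); ring.
have := ler_wpM2l (expR_ge0 (- eta * s%:~R)) (expR_decrement b).
have := ler_wpM2l (ler0n R b) (logistic_ge_expR R eta s).
rewrite payoff_eR; rewrite eE in IH; rewrite -[n.+1]addn1 natrD.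
move: IH; set V := val n _; set w := expR (- eta * _); set z := expR _; set K := 1 / eta + _.
move=> IH h1 h2; rewrite natrDelta2 in h1 h2 *; lra.
Qed.

(** Mirror image: the run drifts left, where [logistic_le_expR] bounds the excess over [A 1 0]. *)
Lemma val_left_run n s : (n <= T)%N -> ~~ left s ->
  ((0 < n)%N -> optact A eta T (T.+1 - n) s = eL) ->
  val n s <= n%:R * (A 1 0)%:~R + (1 / eta + a%:R) * expR (eta * s%:~R).
Proof.
have K0 : 0 <= 1 / eta + a%:R by rewrite addr_ge0 ?ler0n // divr_ge0 // ltW.
elim: n s => [|n IH] s nT Ps act.
  by rewrite mul0r add0r mulr_ge0 ?expR_ge0.
have {}act := act isT.
have IHact : (0 < n)%N -> (T.+1 - n = (T.+1 - n.+1).+1)%N by lia.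
rewrite valS (_ : Num.max _ _ = payoff A eta s eL + val n (s - a%:Z)); last first.
  apply/max_idPl; move/optact_eL: act.
  by rewrite optval_next.
have {}IH : val n (s - a%:Z) <= n%:R * (A 1 0)%:~R +
    (1 / eta + a%:R) * expR (eta * (s - a%:Z)%:~R).
  apply: IH; [exact: ltnW| |].
    apply: contra Ps.
    by apply: swap_gain_mono => //; rewrite ?absDelta1_gt0 ?absDelta2_gt0 //; lia.
  by move=> n0; rewrite IHact //; apply: left_then_left => //; lia.
have eE : expR (eta * (s - a%:Z)%:~R) = expR (eta * s%:~R) * expR (- (eta * a%:R)).
  by rewrite -expRD intrB; congr expR; rewrite -[(a%:Z)%:~R]/(a%:R); ring.
have := ler_wpM2l (expR_ge0 (eta * s%:~R)) (expR_decrement a).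
have := ler_wpM2l (ler0n R a) (logistic_le_expR R eta s).
rewrite payoff_eL; rewrite eE in IH; rewrite -[n.+1]addn1 natrD.
move: IH; set V := val n _; set w := expR (eta * _); set z := expR _; set K := 1 / eta + _.
move=> IH h1 h2; lra.
Qed.

(** A deviation starts a constant run until time [T]. Scaled by [a + b], the guaranteed value beats
    the rate of the run by an integer at least 1 per stage, so [n] is at most the scaled excess. *)
Lemma optact_run_bound n s : 0 < delta1 A -> delta2 A < 0 -> (n <= T)%N ->
  - (a + b)%:Z < s < (a + b)%:Z ->
  optact A eta T (T.+1 - n) s <> (if left s then eL else eR) ->
  n%:R <= (a + b)%:R * (1 / eta + (a + b)%:R) * expR (eta * (a + b)%:R).
Proof.
move=> d1 d2 nT sab; set m := (a + b)%N in sab *.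
have a1 : (1 : R) <= a%:R by rewrite ler1n absDelta1_gt0.
have b1 : (1 : R) <= b%:R by rewrite ler1n absDelta2_gt0.
have d1' : (1 : R) <= (A 0 0)%:~R - (A 0 1)%:~R.
  by rewrite -intrB -/(delta1 A) -[1]/(1%:~R) ler_int; move: d1; lia.
have d2' : (1 : R) <= (A 1 1)%:~R - (A 1 0)%:~R.
  by rewrite -intrB -opprB -/(delta2 A) -[1]/(1%:~R) ler_int; move: d2; lia.
have eta_inv : 0 < 1 / eta by rewrite divr_gt0.
have low := val_lower_bound n s; have n0 : (0 : R) <= n%:R by exact: ler0n.
have m0 : (0 : R) <= m%:R by exact: ler0n.
(* [v] is the limiting stage payoff of the run, [g] the scaled gap between the value of the game and
   [v]. *)
have conclude (k : nat) (x g v : R) : (k <= m)%N -> x <= eta * m%:R ->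
    1 <= g -> val n s <= n%:R * v + (1 / eta + k%:R) * expR x ->
    n%:R * (m%:R * v + g) <= m%:R * val n s ->
    n%:R <= m%:R * (1 / eta + m%:R) * expR (eta * m%:R).
  rewrite -(ler_nat R) -ler_expR => km ex g1 up dn.
  have h1 : (1 / eta + k%:R) * expR x <= (1 / eta + m%:R) * expR (eta * m%:R).
    by apply: ler_pM => //; rewrite ?expR_ge0 ?lerD2l // addr_ge0 ?ler0n // ltW.
  have h2 := ler_wpM2l m0 up; have h3 := ler_wpM2l m0 h1; have h4 := ler_wpM2l n0 g1.
  move: dn h2 h3 h4; set V := val n s; lra.
case: ifPn => Ps neq.
  have {neq}act : optact A eta T (T.+1 - n) s = eR.
    by case: (optact_cases (T.+1 - n) s).
  apply: (conclude b (- eta * s%:~R)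
      (b%:R * ((A 0 0)%:~R - (A 0 1)%:~R)) (A 0 1)%:~R).
  - exact: leq_addl.
  - rewrite mulNr -mulrN ler_pM2l // -[m%:R]/(m%:Z%:~R) -intrN ler_int lerNl ltW //.
    by case/andP: sab.
  - exact: mulr_ege1.
  - exact: val_right_run.
  - apply: le_trans low; rewrite /m natrD natrDelta1 natrDelta2 le_eqVlt.
    by apply/orP; left; apply/eqP; ring.
have {neq}act : optact A eta T (T.+1 - n) s = eL.
  by case: (optact_cases (T.+1 - n) s).
apply: (conclude a (eta * s%:~R)
    (a%:R * ((A 1 1)%:~R - (A 1 0)%:~R)) (A 1 0)%:~R).
- exact: leq_addr.
- rewrite ler_pM2l // -[m%:R]/(m%:Z%:~R) ler_int ltW //.
  by case/andP: sab.
- exact: mulr_ege1.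
- exact: val_left_run.
- apply: le_trans low; rewrite /m natrD natrDelta1 natrDelta2 le_eqVlt.
  by apply/orP; left; apply/eqP; ring.
Qed.

(** * The first deviation and the period before it *)

Definition threshold_play (i : nat) : 'cV[int]_2 :=
  if left (orbit i) then eL else eR.

(** Index [i] stands for time [i.+1], so this is the length of the prefix following the rule; [find]
    returns [T] if nothing deviates. *)
Definition first_deviation : nat :=
  find (fun i => optplay A eta T i.+1 != threshold_play i) (iota 0 T).

Local Notation play_len := first_deviation.

Lemma first_deviation_le : (play_len <= T)%N.
Proof. by rewrite (leq_trans (find_size _ _)) ?size_iota. Qed.

Lemma optplay_threshold i : (i < play_len)%N ->
  optplay A eta T i.+1 = threshold_play i.
Proof.
move=> id; have iT := leq_trans id first_deviation_le.
by have /negbFE/eqP := before_find 0%N id; rewrite nth_iota.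
Qed.

Lemma next_state_threshold_play i :
  next_state A (orbit i) (threshold_play i) = orbit i.+1.
Proof.
rewrite /threshold_orbit iterS -/(orbit i) /threshold_step /threshold_play.
by case: ifP; rewrite ?next_state_eL ?next_state_eR.
Qed.

Lemma optstate_threshold i : (i <= play_len)%N -> optstate A eta T i.+1 = orbit i.
Proof.
elim: i => [|i IH] id; first exact: optstate1.
by rewrite optstate_rec // IH ?(ltnW id) // optplay_threshold // next_state_threshold_play.
Qed.

Lemma first_deviation_bound : 0 < delta1 A -> delta2 A < 0 ->
  (T - play_len)%:R <= (a + b)%:R * (1 / eta + (a + b)%:R) * expR (eta * (a + b)%:R).
Proof.
move=> d1 d2; have := first_deviation_le; rewrite leq_eqVlt => /orP[/eqP dT|dT].
  by rewrite dT subnn !mulr_ge0 ?expR_ge0 ?ler0n // addr_ge0 ?ler0n // divr_ge0 // ltW.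
apply: (@optact_run_bound _ (orbit play_len)) => //; first exact: leq_subr.
  by apply: threshold_orbit_bound; rewrite ?absDelta1_gt0 ?absDelta2_gt0.
(* For [n = T - play_len] the time [T.+1 - n] is [play_len.+1], the first deviating one; its state
   is still on the orbit. *)
rewrite subSn ?leq_subr // subKn ?(ltnW dT) //.
have : has (fun i => optplay A eta T i.+1 != threshold_play i) (iota 0 T).
  by rewrite has_find size_iota.
move/(nth_find 0%N); rewrite -/play_len nth_iota // add0n.
by rewrite /optplay optstate_threshold // => /eqP.
Qed.

(** Length [p * p] leaves room for [p] successive shifts by any candidate period [q < p]. *)
Lemma first_deviation_period (p := cycle_length a b) : (p * p <= play_len)%N ->
  least_period (optplay A eta T) play_len p.
Proof.
have a0 := absDelta1_gt0; have b0 := absDelta2_gt0.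
have perO i : orbit (i + p) = orbit i by exact: threshold_orbit_periodic.
move=> pp; split; first split; first exact: cycle_length_gt0.
  by case=> // i _ id; rewrite addSn !optplay_threshold ?/threshold_play ?perO //; lia.
move=> q [q0 perq]; rewrite leqNgt; apply/negP => qp.
(* A period q of the play shifts the orbit by a constant, which must be 0 since
   the orbit is bounded; then q is a return time of the orbit to 0. *)
have shift i : (i + q <= play_len)%N -> orbit (i + q) = orbit i + orbit q.
  elim: i => [|i IH] iq; first by rewrite add0n /threshold_orbit /= add0r.
  have /perq := iq; rewrite addSn in iq *; move=> /(_ isT).
  rewrite !optplay_threshold ?(leq_ltn_trans (leq_addr q i)) // => E.
  rewrite -!next_state_threshold_play E IH ?(ltnW iq) //.
  by rewrite /threshold_play; case: ifP; rewrite ?next_state_eL ?next_state_eR addrAC.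
have multiple j : (j * q <= play_len)%N -> orbit (j * q) = j%:Z * orbit q.
  elim: j => [|j IH] jq; first by rewrite mul0n mul0r.
  rewrite mulSnr in jq *; rewrite shift // IH; last by lia.
  by rewrite -addn1 PoszD mulrDl mul1r.
have return_p j : orbit (j * p) = 0.
  by elim: j => // j IH; rewrite mulSnr perO.
have p0 : (0 < p)%N by exact: cycle_length_gt0.
have pq : (p * q <= play_len)%N by apply: leq_trans pp; rewrite leq_mul // ltnW.
have /esym/eqP := multiple p pq; rewrite mulnC return_p mulf_eq0.
case/orP => [|/eqP Oq]; first by move/eqP; lia.
by move: qp; rewrite ltnNge => /negP; apply; apply: threshold_orbit_return Oq.
Qed.

End OptimalPlay.

(** * Asymptotics in the horizon *)

Theorem theorem5p1 (R : realType) (A : 'M[int]_2) (eta : nat -> R) (c C : R)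
    (hD1 : 0 < Delta1 A) (hD2 : Delta2 A < 0)
    (hd1 : 0 < delta1 A) (hd2 : delta2 A < 0)
    (hD : `|Delta1 A| < `|Delta2 A|)
    (hc : 0 < c) (hcC : c <= C)
    (heta : forall T : nat, (1 <= T)%N ->
       0 < eta T /\ c / Num.sqrt T%:R <= eta T <= C / Num.sqrt T%:R) :
  exists td : nat -> nat,
    [/\ \forall T \near \oo, (td T <= T)%N,
        (fun T : nat => T%:R - (td T)%:R : R) =o_\oo (fun T : nat => T%:R : R) &
        \forall T \near \oo,
          least_period (optplay A (eta T) T) (td T) (lcm_period A)].
Proof.
pose td T := first_deviation R A (eta T) T.
have tdT T : (td T <= T)%N by exact: first_deviation_le.
pose m : R := (`|Delta1 A| + `|Delta2 A|)%N%:R.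
(* Comes from [first_deviation_bound] with [1 / eta <= sqrt T / c], [eta <= C] and [1 <= sqrt T]. *)
pose K := m * (1 / c + m) * expR (C * m).
have m0 : 0 <= m by exact: ler0n.
have C0 : 0 < C by exact: lt_le_trans hcC.
have tail T : (0 < T)%N -> T%:R - (td T)%:R <= K * Num.sqrt T%:R.
  move=> T0; have [eta0 /andP[lo hi]] := heta T T0.
  have T1 : (1 : R) <= Num.sqrt T%:R by rewrite -[leLHS]sqrtr1 ler_wsqrtr // ler1n.
  have sT0 : 0 < Num.sqrt T%:R :> R by exact: lt_le_trans T1.
  rewrite -natrB //; apply: le_trans (first_deviation_bound R A (eta T) T eta0 hD1 hD2 hd1 hd2) _.
  rewrite -/m /K [leRHS]mulrAC; apply: ler_pM => //.
  - by rewrite mulr_ge0 // addr_ge0 // divr_ge0 // ltW.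
  - rewrite -mulrA ler_wpM2l // mulrDl lerD //; last by rewrite ler_peMr.
    rewrite ler_pdivrMr // [1 / c]mul1r -mulrA ler_pdivlMl // mulr1 mulrC.
    by rewrite -ler_pdivrMr.
  - rewrite ler_expR ler_wpM2r //; apply: le_trans hi _.
    by rewrite ler_pdivrMr // ler_peMr // ltW.
have small (eps : R) : 0 < eps -> \forall T \near \oo, T%:R - (td T)%:R <= eps * T%:R.
  move=> eps0; near=> n.
  have n0 : (0 < n)%N by near: n; exact: nbhs_infty_ge.
  apply: le_trans (tail _ n0) _.
  have K0 : 0 <= K by rewrite !mulr_ge0 ?expR_ge0 // addr_ge0 // divr_ge0 // ltW.
  (* What remains is [K / eps <= sqrt n], true once [n >= (K / eps) ^ 2]. *)
  rewrite -{2}(@sqr_sqrtr _ n%:R) ?ler0n // expr2 mulrA ler_wpM2r ?sqrtr_ge0 //.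
  rewrite -ler_pdivrMl // mulrC -[leLHS]ger0_norm ?divr_ge0 ?(ltW eps0) //.
  rewrite -sqrtr_sqr ler_wsqrtr //; near: n; exact: nbhs_infty_ger.
exists td; split.
- exact: nearW.
- apply/eqoP => eps eps0; near=> n.
  rewrite !ger0_norm ?ler0n ?subr_ge0 ?ler_nat //.
  by near: n; exact: small.
- near=> n.
  have n0 : (0 < n)%N by near: n; exact: nbhs_infty_ge.
  have [eta0 _] := heta n n0.
  apply: first_deviation_period => //.
  set p := cycle_length _ _.
  (* A tail of at most [n / 2] leaves [td n >= n / 2 >= p * p]. *)
  have : (2 * (p * p) <= n)%N by near: n; exact: nbhs_infty_ge.
  have : n%:R - (td n)%:R <= 2^-1 * n%:R :> R.
    by near: n; apply: small; rewrite invr_gt0.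
  rewrite -!(ler_nat R) natrM -/(td n); lra.
Unshelve. all: by end_near.
Qed.
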